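(* Let $\widehat M$ be a cooperative Markov game with underlying MMDP $M$, let $(S_{target},S_{avoid})$ be a reach-avoid objective, and let $\pi=(\pi_{comm},\pi_{act})\in\Pi^{pos}_{comm}(\mathcal O,K)\times\Pi^{pos}_{act}(M)$. Assume $\sum_{t\ge1}H_t<\infty$. Then $$\mathbb P_{M_{\pi_{act}}}\big((\neg S_{avoid})\,\mathcal U\,S_{target}\big)-\mathbb P_{\widehat M_{\pi}}\big((\neg S_{avoid})\,\mathcal U\,S_{target}\big)\;\le\;\sqrt{1-\exp\big(-D_{(\pi_{comm},\pi_{act})}\big)} ,$$ where the right-hand side is read as $1$ if $D_{(\pi_{comm},\pi_{act})}=+\infty$.
   Context: MMDP: there are $N\ge1$ agents, identified with $[N]=\{1,\dots,N\}$. Agent $i$ has a finite local state set $\mathcal S^i$, finite local action set $\mathcal A^i$, local transition function $P^i:\mathcal S^i\times\mathcal A^i\to\Delta(\mathcal S^i)$ and initial local state $s^i_{init}$. Joint states $\mathcal S=\prod_i\mathcal S^i$, joint actions $\mathcal A=\prod_i\mathcal A^i$, joint transitions $P(s,a)(u)=\prod_{i}P^i(s^i,a^i)(u^i)$, initial state $s_{init}=(s^1_{init},\dots,s^N_{init})$. A positional joint action policy is a map $\pi_{act}:\mathcal S\to\Delta(\mathcal A)$; $\Pi^{pos}_{act}(M)$ is the set of these. Cooperative Markov game $\widehat M=(M,\mathcal O^1,\dots,\mathcal O^N,\mathcal L^1,\dots,\mathcal L^N,K)$: each $\mathcal S^i=\mathcal O^i\times\mathcal L^i$ (public part $o^i$,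 local part $l^i$); $\mathcal O=\prod_i\mathcal O^i$, $\mathcal L=\prod_i\mathcal L^i$, and a joint state is written $s=(o,l)$. For $c\subseteq[N]$, $\mathcal O^c=\prod_{j\in c}\mathcal O^j$, $\mathcal L^c=\prod_{j\in c}\mathcal L^j$, $\mathcal A^c=\prod_{j\in c}\mathcal A^j$, and $o^c,l^c,a^c$ denote restrictions to coordinates in $c$. $K\in\{0,\dots,N\}$ and $\mathcal A_{comm}$ is the set of subsets of $[N]$ of size $K$ (so $\mathcal A_{comm}=\{\emptyset\}$ if $K=0$). A positional communication policy is a map $\pi_{comm}:\mathcal O\to\Delta(\mathcal A_{comm})$; $\Pi^{pos}_{comm}(\mathcal O,K)$ is the set of these. Reach-avoid objective: disjoint sets $S_{target},S_{avoid}\subseteq\mathcal S$; put $\mathcal T=S_{target}\cup S_{avoid}$. Full-communication process $M_{\pi_{act}}$: random sequence $S_0=s_{init},A_1,S_1,A_2,S_2,\dots$ with $\mathbb P(A_t=a,S_t=s'\mid S_0,A_1,\dots,S_{t-1}=s)=\pi_{act}(s)(a)P(s,a)(s')$. Write $S_t=(O_t,L_t)$ and $A^c_t,O^c_t,L^c_t$ (resp. $A^i_t,O^i_t,L^i_t$) for components in $c$ (resp. $i$). The process is regarded as stopped upon entering $\mathcal T$: with $E_{t}=\{S_0,\dots,S_{t}\notin\mathcal T\}$, every probability of an event concerning times $t-1,t$ is the probability of that event intersected with $E_{t-1}$, and conditional probabilities condition on the conditioning event intersected with $E_{t-1}$. For $c\subseteq[N]$ and $t\ge1$ let $q^c_t(a^c,o^c_1,l^c_1\mid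 o,l^c)=\mathbb P(A^c_t=a^c,O^c_t=o^c_1,L^c_t=l^c_1\mid O_{t-1}=o,L^c_{t-1}=l^c,E_{t-1})$ (write $q^i_t$ for $c=\{i\}$; arbitrary if the conditioning event has probability $0$). Restricted-communication process $\widehat M_\pi$, $\pi=(\pi_{comm},\pi_{act})$: random sequence $\hat S_0=s_{init},\hat A_1,\hat S_1,\dots$ (stopped upon entering $\mathcal T$) such that for any history ending in $\hat S_{t-1}=(o,l)\notin\mathcal T$, $\mathbb P(\hat A_t=a,\hat S_t=(o_1,l_1)\mid\text{history})=\sum_{c\in\mathcal A_{comm}}\pi_{comm}(o)(c)\,q^c_t(a^c,o^c_1,l^c_1\mid o,l^c)\prod_{i\notin c}q^i_t(a^i,o^i_1,l^i_1\mid o,l^i)$ (the factor for $c=\emptyset$ is $1$). $\mathbb P_{X}((\neg S_{avoid})\mathcal U S_{target})$ for a process $X$ is the probability that some state at time $t$ lies in $S_{target}$ while no state at times $<t$ lies in $S_{avoid}$. Cost: $H_t=H(A_tS_t\mid S_0A_1S_1\dots A_{t-1}S_{t-1})$ is the conditional entropy of the (stopped) full-communication process, i.e. $-\sum_{h}\mathbb P(h\cap E_{t-1})\sum_{a,s'}p_h(a,s')\log p_h(a,s')$ over histories $h$ of length $t-1$, with $p_h$ the conditional law of $(A_t,S_t)$ given $h$. With $w'(o,i)=\sum_{c\in\mathcal A_{comm},\,i\notin c}\pi_{comm}(o)(c)$ and $w''(o,c)=\pi_{comm}(o)(c)$: $G^i=\sum_{t\ge1}\sum_{o\in\mathcal O,l^i\in\mathcal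 L^i}w'(o,i)\,\mathbb P(O_{t-1}=o,L^i_{t-1}=l^i,E_{t-1})\Big(-\sum_{a^i,o^i_1,l^i_1}q^i_t\log q^i_t\Big)$, where $q^i_t=q^i_t(a^i,o^i_1,l^i_1\mid o,l^i)$; $G^c=\sum_{t\ge1}\sum_{o\in\mathcal O,l^c\in\mathcal L^c}w''(o,c)\,\mathbb P(O_{t-1}=o,L^c_{t-1}=l^c,E_{t-1})\Big(-\sum_{a^c,o^c_1,l^c_1}q^c_t\log q^c_t\Big)$; $D_{(\pi_{comm},\pi_{act})}=\sum_{i\in[N]}G^i+\sum_{c\in\mathcal A_{comm}}G^c-\sum_{t\ge1}H_t$. Convention $0\log0=0$. *)

(* Defs.v *)
From HB Require Import structures.
From mathcomp Require Import all_boot all_order all_algebra.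
From mathcomp Require Import all_classical all_reals all_analysis.
Unset Printing Implicit Defensive.
Import Order.TTheory GRing.Theory Num.Theory.
Local Open Scope ring_scope.

Definition is_dist (R : realType) (X : finType) (f : {ffun X -> R}) : Prop :=
  (forall x, 0 <= f x) /\ \sum_(x : X) f x = 1.

Definition xlnx (R : realType) (x : R) : R := if x == 0 then 0 else x * ln x.

Definition entr (R : realType) (X : finType) (p : X -> R) : R :=
  - \sum_(x : X) xlnx R (p x).

Section Game.
Context (R : realType) (N : nat) (O L A : 'I_N -> finType) (K : nat).

(* joint public states, joint local parts, joint actions, joint states *)
Definition jO : finType := {dffun forall i : 'I_N, O i}.
Definition jL : finType := {dffun forall i : 'I_N, L i}.
Definition jA : finType := {dffun forall i : 'I_N, A i}.
Definition jS : finType := (jO * jL)%type.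

Definition sub (c : {set 'I_N}) : finType := {j : 'I_N | j \in c}.
Definition rO (c : {set 'I_N}) : finType := {dffun forall j : sub c, O (val j)}.
Definition rL (c : {set 'I_N}) : finType := {dffun forall j : sub c, L (val j)}.
Definition rA (c : {set 'I_N}) : finType := {dffun forall j : sub c, A (val j)}.

Definition restr (T : 'I_N -> finType) (x : {dffun forall i : 'I_N, T i})
  (c : {set 'I_N}) : {dffun forall j : sub c, T (val j)} :=
  finfun (fun j : sub c => x (val j)).
Arguments restr {T} x c.

Definition Acomm : finType := {c : {set 'I_N} | #|c| == K}.

Context (P : forall i : 'I_N, (O i * L i)%type -> A i -> {ffun (O i * L i)%type -> R}).
Context (sinit : jS) (pact : jS -> {ffun jA -> R}) (pcomm : jO -> {ffun Acomm -> R}).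
Context (Starg Savoid : {set jS}).

Definition Tset : {set jS} := Starg :|: Savoid.

Definition Pj (s : jS) (a : jA) (u : jS) : R :=
  \prod_(i < N) P i (s.1 i, s.2 i) (a i) (u.1 i, u.2 i).

Definition kfull (t : nat) (s : jS) (x : (jA * jS)%type) : R :=
  pact s x.1 * Pj s x.1 x.2.

(* A history of length n is S_0 = sinit followed by an n-tuple of (A_k, S_k). *)
Definition stateAt n (h : n.-tuple (jA * jS)%type) (k : nat) : jS :=
  nth sinit (sinit :: map snd h) k.
Arguments stateAt {n} h k.

(* E_{m-1}: the states at times 0, ..., m-1 all lie outside T *)
Definition Eb n (h : n.-tuple (jA * jS)%type) (m : nat) : bool :=
  [forall k : 'I_m, stateAt h k \notin Tset].
Arguments Eb {n} h m.

(* probability weight of a history under a (time-indexed) kernel;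
   ker t s (a,s') = P(A_t = a, S_t = s' | S_{t-1} = s) *)
Definition pathW (ker : nat -> jS -> (jA * jS)%type -> R) n
  (h : n.-tuple (jA * jS)%type) : R :=
  \prod_(k < n) ker k.+1 (stateAt h k) (tnth h k).
Arguments pathW ker {n} h.

(* P(O_n = o, L^c_n = lc, E_n) in the full-communication process *)
Definition den (n : nat) (c : {set 'I_N}) (o : jO) (lc : rL c) : R :=
  \sum_(h : n.-tuple (jA * jS)%type |
          [&& Eb h n.+1, (stateAt h n).1 == o & restr (stateAt h n).2 c == lc])
    pathW kfull h.

(* P(A^c_{n+1} = ac, O^c_{n+1} = o1c, L^c_{n+1} = l1c, O_n = o, L^c_n = lc, E_n) *)
Definition num (n : nat) (c : {set 'I_N}) (o : jO) (lc : rL c)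
  (x : (rA c * rO c * rL c)%type) : R :=
  \sum_(h : n.+1.-tuple (jA * jS)%type |
          [&& Eb h n.+1, (stateAt h n).1 == o, restr (stateAt h n).2 c == lc,
              restr (tnth h ord_max).1 c == x.1.1,
              restr (tnth h ord_max).2.1 c == x.1.2 &
              restr (tnth h ord_max).2.2 c == x.2])
    pathW kfull h.

(* A family q t c o lc of conditional laws q^c_t( . | o, l^c):
   it is the true conditional probability whenever the conditioning event has
   positive probability, and an arbitrary distribution otherwise. *)
Definition q_family := nat -> forall c : {set 'I_N}, jO -> forall lc : rL c,
  {ffun (rA c * rO c * rL c)%type -> R}.

Definition is_cond_family (q : q_family) : Prop :=
  (forall n c o lc, 0 < den n c o lc ->
     forall x, q n.+1 c o lc x = num n c o lc x / den n c o lc) /\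
  (forall n c o lc, den n c o lc = 0 -> is_dist R _ (q n.+1 c o lc)).

Definition khat (q : q_family) (t : nat) (s : jS) (x : (jA * jS)%type) : R :=
  \sum_(c : Acomm)
     pcomm s.1 c
     * q t (val c) s.1 (restr s.2 (val c))
         (restr x.1 (val c), restr x.2.1 (val c), restr x.2.2 (val c))
     * \prod_(i < N | i \notin val c)
         q t [set i] s.1 (restr s.2 [set i])
           (restr x.1 [set i], restr x.2.1 [set i], restr x.2.2 [set i]).

(* P_X((not S_avoid) U S_target) for the stopped process with kernel ker:
   sum over t of P(S_0,...,S_{t-1} notin T, S_t in S_target). *)
Definition reachP (ker : nat -> jS -> (jA * jS)%type -> R) : \bar R :=
  (\sum_(0 <= n <oo)
     (\sum_(h : n.-tuple (jA * jS)%type | Eb h n && (stateAt h n \in Starg))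
         pathW ker h)%:E)%E.

(* H_{n+1} = H(A_{n+1} S_{n+1} | S_0 A_1 ... S_n) *)
Definition Hent (n : nat) : R :=
  \sum_(h : n.-tuple (jA * jS)%type | Eb h n.+1)
    pathW kfull h * entr R _ (kfull n.+1 (stateAt h n)).

Definition Hsum : \bar R := (\sum_(0 <= n <oo) (Hent n)%:E)%E.

Definition wprime (o : jO) (i : 'I_N) : R :=
  \sum_(c : Acomm | i \notin val c) pcomm o c.

Definition Gi (q : q_family) (i : 'I_N) : \bar R :=
  (\sum_(0 <= n <oo)
     (\sum_(o : jO) \sum_(li : rL [set i])
        wprime o i * den n [set i] o li * entr R _ (q n.+1 [set i] o li))%:E)%E.

Definition Gc (q : q_family) (c : Acomm) : \bar R :=
  (\sum_(0 <= n <oo)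
     (\sum_(o : jO) \sum_(lc : rL (val c))
        pcomm o c * den n (val c) o lc * entr R _ (q n.+1 (val c) o lc))%:E)%E.

Definition Dcost (q : q_family) : \bar R :=
  (\sum_(i < N) Gi q i + \sum_(c : Acomm) Gc q c - Hsum)%E.

End Game.

(* sqrt(1 - exp(-D)), read as 1 when D = +oo (D = -oo cannot occur when
   sum_t H_t < +oo; the value chosen there is immaterial). *)
Definition bound (R : realType) (D : \bar R) : R :=
  match D with
  | EFin r => Num.sqrt (1 - expR (- r))
  | _ => 1
  end.

(* Main.v *)
(** Fix a horizon n and let p and r be the laws of the first n steps of the
    full- and of the restricted-communication process, both continued with the
    same kernel once T is entered. Reaching the target within n steps is an
    event on this finite space, so the Bretagnolle-Huber inequality bounds the
    difference of its probabilities by sqrt (1 - exp (- KL(p, r))). By the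
    chain rule KL(p, r) is a sum of one-step divergences over the times before
    stopping. Concavity of ln, applied to the mixture over the communicating
    set c, bounds - ln of the restricted kernel by a combination of the - ln
    q^c and - ln q^i, and the law of total probability turns their
    expectations into the entropy terms of G^c and G^i. So the n-th step
    divergence is at most the n-th term of D; these terms are nonnegative,
    hence their partial sums stay below D. *)

Require Import Defs.
From HB Require Import structures.
From mathcomp Require Import all_boot all_order all_algebra.
From mathcomp Require Import all_classical all_reals all_analysis.
From mathcomp Require Import ring lra.
Import Order.TTheory GRing.Theory Num.Theory.
Set Implicit Arguments.
Unset Strict Implicit.
Local Open Scope ring_scope.

Section FiniteSums.

Lemma sum_dffun_prod (R : comPzSemiRingType) (I : finType) (T : I -> finType)
    (F : forall i, T i -> R) :
  \sum_(f : {dffun forall i, T i}) \prod_i F i (f i)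
  = \prod_i \sum_(x : T i) F i x.
Proof.
rewrite (reindex (@dffun_of_fprod I T)); last exact/onW_bij/dffun_of_fprod_bij.
transitivity (\sum_(t : fprod T) \prod_(i in I) [ffun x => F i x] (t i)).
  by apply: eq_bigr => t _; apply: eq_bigr => i _; rewrite !ffunE.
rewrite big_fprod; under [RHS]eq_bigr do rewrite (big_tag F).
rewrite bigA_distr_big_dep; apply: eq_bigr => g /familyP gT.
by apply: eq_bigr => i _; have /eqP e := gT i; rewrite !(untagE _ _ e) ffunE.
Qed.

Lemma card_dffun (I : finType) (T : I -> finType) :
  #|{dffun forall i, T i}| = (\prod_i #|T i|)%N.
Proof. by rewrite -card_fprod (bij_eq_card (@dffun_of_fprod_bij I T)). Qed.

Lemma sum_fibers (R : nmodType) (X Y : finType) (Q : pred X) (u : X -> Y)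
    (F : X -> Y -> R) :
  \sum_y \sum_(x | Q x && (u x == y)) F x y = \sum_(x | Q x) F x (u x).
Proof.
rewrite [RHS](partition_big u xpredT)//=; apply: eq_bigr => y _.
by apply: eq_bigr => x /andP[_ /eqP->].
Qed.

Lemma rcons_tuple_bij (T : finType) n :
  bijective (fun hx : n.-tuple T * T => rcons_tuple hx.1 hx.2).
Proof.
apply: inj_card_bij; last by rewrite card_prod !card_tuple expnSr.
move=> [h x] [h' x'] /(congr1 val)/= /rcons_inj[hh' ->].
by congr pair; exact: val_inj.
Qed.

Lemma sum_rcons_tuple (R : nmodType) (T : finType) n (F : n.+1.-tuple T -> R) :
  \sum_(h : n.+1.-tuple T) F h
  = \sum_(h : n.-tuple T) \sum_(x : T) F (rcons_tuple h x).
Proof.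
rewrite pair_big (reindex (fun hx => rcons_tuple hx.1 hx.2))//=.
exact/onW_bij/rcons_tuple_bij.
Qed.

Lemma sum_tuple0 (R : nmodType) (T : finType) (F : 0.-tuple T -> R) :
  \sum_(h : 0.-tuple T) F h = F [tuple].
Proof. by rewrite (big_pred1 [tuple])// => h; exact/esym/eqP/tuple0. Qed.

Lemma eq_weighted_sum (R : numDomainType) (X : finType) (Q : pred X)
    (w F G : X -> R) :
    (forall x, 0 <= w x) -> (forall x, Q x -> 0 < w x -> F x = G x) ->
  \sum_(x | Q x) w x * F x = \sum_(x | Q x) w x * G x.
Proof.
move=> w0 FG; apply: eq_bigr => x Qx; have := w0 x.
by rewrite le_eqVlt => /predU1P[<-|/(FG _ Qx)->//]; rewrite !mul0r.
Qed.

Lemma ler_weighted_sum (R : numDomainType) (X : finType) (Q : pred X)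
    (w F G : X -> R) :
    (forall x, 0 <= w x) -> (forall x, Q x -> 0 < w x -> F x <= G x) ->
  \sum_(x | Q x) w x * F x <= \sum_(x | Q x) w x * G x.
Proof.
move=> w0 FG; apply: ler_sum => x Qx; have := w0 x.
rewrite le_eqVlt => /predU1P[<-|wx]; first by rewrite !mul0r.
by rewrite ler_pM2l// FG.
Qed.

End FiniteSums.

Section Distributions.
Context {R : numDomainType}.

Definition distribution (X : finType) (p : X -> R) : Prop :=
  (forall x, 0 <= p x) /\ \sum_x p x = 1.

Definition abscont (X : finType) (p r : X -> R) : Prop :=
  forall x, 0 < p x -> 0 < r x.

Lemma distribution_le1 (X : finType) (p : X -> R) x :
  distribution p -> p x <= 1.
Proof. by move=> [p0 <-]; rewrite (bigD1 x)//= lerDl sumr_ge0. Qed.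

Lemma distribution_mix (I X : finType) (w : I -> R) (p : I -> X -> R) :
    distribution w -> (forall i, distribution (p i)) ->
  distribution (fun x => \sum_i w i * p i x).
Proof.
move=> [w0 w1] p_dist; split=> [x|].
  by apply: sumr_ge0 => i _; rewrite mulr_ge0// (p_dist i).1.
rewrite exchange_big -w1; apply: eq_bigr => i _.
by rewrite -mulr_sumr (p_dist i).2 mulr1.
Qed.

Lemma distribution_joint (X Y : finType) (p : X -> R) (k : X -> Y -> R) :
    distribution p -> (forall x, distribution (k x)) ->
  distribution (fun xy : X * Y => p xy.1 * k xy.1 xy.2).
Proof.
move=> [p0 p1] k_dist; split=> [xy|]; first by rewrite mulr_ge0// (k_dist _).1.
rewrite -(pair_bigA _ (fun x y => p x * k x y))/= -p1; apply: eq_bigr => x _.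
by rewrite -mulr_sumr (k_dist x).2 mulr1.
Qed.

Lemma distribution_dffun (I : finType) (T : I -> finType)
    (p : forall i, T i -> R) :
    (forall i, distribution (p i)) ->
  distribution (fun f : {dffun forall i, T i} => \prod_i p i (f i)).
Proof.
move=> p_dist; split=> [f|].
  by apply: prodr_ge0 => i _; exact: (p_dist i).1.
by rewrite sum_dffun_prod big1// => i _; exact: (p_dist i).2.
Qed.

Lemma distribution_comp_bij (X Y : finType) (phi : X -> Y) (p : Y -> R) :
  bijective phi -> distribution p -> distribution (p \o phi).
Proof.
move=> phi_bij [p0 p1]; split=> [x|]; first exact: p0.
by rewrite -p1 [RHS](reindex phi)//; exact: onW_bij.
Qed.

Lemma weighted_sum_gt0 (X : finType) (p y : X -> R) :
  distribution p -> abscont p y -> 0 < \sum_x p x * y x.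
Proof.
move=> [p0 p1] py.
have [x px] : exists x, 0 < p x.
  have /psumr_neq0P[//|x /= px] : \sum_x p x <> 0; last by exists x.
  by rewrite p1; apply/eqP; exact: oner_neq0.
rewrite (bigD1 x)//= ltr_pwDl ?mulr_gt0 ?py//; apply: sumr_ge0 => z _.
have := p0 z; rewrite le_eqVlt => /predU1P[<-|pz]; first by rewrite mul0r.
by rewrite mulr_ge0// ltW// py.
Qed.

End Distributions.

Section Divergence.
Context {R : realType} {X : finType}.
Implicit Types (p r f g : X -> R) (B : pred X).

Lemma ln_prod (I : finType) (Q : pred I) (F : I -> R) :
    (forall i, Q i -> 0 < F i) ->
  ln (\prod_(i | Q i) F i) = \sum_(i | Q i) ln (F i).
Proof.
move=> F0; rewrite -[RHS]expRK expR_sum; congr ln.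
by apply: eq_bigr => i Qi; rewrite lnK// posrE F0.
Qed.

Lemma jensen_ln p f : distribution p -> abscont p f ->
  \sum_x p x * ln (f x) <= ln (\sum_x p x * f x).
Proof.
move=> p_dist pf; set m := \sum_x p x * f x.
have m0 : 0 < m by exact: weighted_sum_gt0.
have -> : ln m = \sum_x p x * (ln m + (f x / m - 1)).
  under eq_bigr do rewrite mulrDr mulrBr mulr1 mulrA.
  rewrite big_split/= sumrB -!mulr_suml p_dist.2 mul1r divff ?gt_eqF//.
  by rewrite subrr addr0.
apply: ler_weighted_sum => [|x _ px]; first exact: p_dist.1.
rewrite -lerBlDl -ln_div ?posrE ?pf//.
rewrite -[in ln _](subrK 1 (f x / m)) addrC; apply: le_ln1Dx.
by rewrite ltrBrDr addNr divr_gt0// pf.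
Qed.

(* Since ln 0 = 0 here, this is the Kullback-Leibler divergence only when p is
   absolutely continuous with respect to r. *)
Definition kl p r : R := \sum_x p x * (ln (p x) - ln (r x)).

Lemma kl_self p : kl p p = 0.
Proof. by rewrite /kl big1// => x _; rewrite subrr mulr0. Qed.

Lemma gibbs_inequality p f : distribution p -> (forall x, 0 <= f x) ->
  abscont p f -> expR (- kl p f) <= \sum_x f x.
Proof.
move=> p_dist f0 pf; have fp_gt0 : abscont p (fun x => f x / p x).
  by move=> x px; rewrite divr_gt0// pf.
have klE : - kl p f = \sum_x p x * ln (f x / p x).
  rewrite -sumrN; under eq_bigr do rewrite -mulrN opprB.
  apply: eq_weighted_sum => [|x _ px]; first exact: p_dist.1.
  by rewrite ln_div ?posrE ?pf.
have mean_le : \sum_x p x * (f x / p x) <= \sum_x f x.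
  apply: ler_sum => x _; have := p_dist.1 x.
  rewrite le_eqVlt => /predU1P[<-|px]; first by rewrite mul0r.
  by rewrite mulrCA divff ?gt_eqF// mulr1.
have mean_gt0 := weighted_sum_gt0 p_dist fp_gt0.
apply: le_trans mean_le; rewrite -[leRHS]lnK ?posrE// ler_expR klE.
exact: jensen_ln.
Qed.

Lemma kl_ge0 p r : distribution p -> distribution r -> abscont p r ->
  0 <= kl p r.
Proof.
move=> p_dist [r0 r1] pr; have := gibbs_inequality p_dist r0 pr.
by rewrite r1 expR_le1 oppr_le0.
Qed.

Lemma sum_predC p B : distribution p ->
  \sum_(x | ~~ B x) p x = 1 - \sum_(x | B x) p x.
Proof.
by move=> [_ <-]; rewrite [X in X - _](bigID B)/= addrAC subrr add0r.
Qed.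

Definition splice p r B (x : X) : R := if B x then r x else p x.

Lemma kl_splice p r B :
  kl p r = kl p (splice p r B) + kl p (splice p r (predC B)).
Proof.
rewrite /kl -big_split/=; apply: eq_bigr => x _.
by rewrite /splice/=; case: (B x); ring.
Qed.

Lemma gibbs_splice p r B : distribution p -> distribution r -> abscont p r ->
  expR (- kl p (splice p r B)) <= 1 - (\sum_(x | B x) p x - \sum_(x | B x) r x).
Proof.
move=> p_dist r_dist pr.
have -> : 1 - (\sum_(x | B x) p x - \sum_(x | B x) r x) = \sum_x splice p r B x.
  by rewrite /splice big_if/= sum_predC//; ring.
apply: gibbs_inequality => // x; rewrite /splice; case: ifP => // _.
- exact: r_dist.1.
- exact: p_dist.1.
- exact: pr.
Qed.

(* The two spliced measures have masses 1 - d and 1 + d, where d = p(B) - r(B),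
   so exp (- kl p r) is at most 1 - d^2. *)
Lemma bretagnolle_huber p r B :
    distribution p -> distribution r -> abscont p r ->
  \sum_(x | B x) p x - \sum_(x | B x) r x <= Num.sqrt (1 - expR (- kl p r)).
Proof.
move=> p_dist r_dist pr; set d := _ - _.
have on_B : expR (- kl p (splice p r B)) <= 1 - d by exact: gibbs_splice.
have off_B : expR (- kl p (splice p r (predC B))) <= 1 + d.
  apply: le_trans (gibbs_splice _ p_dist r_dist pr) _.
  by rewrite !sum_predC// /d; lra.
have expR_le : expR (- kl p r) <= (1 - d) * (1 + d).
  by rewrite (kl_splice p r B) opprD expRD ler_pM ?expR_ge0.
by apply: (le_trans (ler_norm _)); rewrite -sqrtr_sqr ler_wsqrtr//; lra.
Qed.

Lemma entr_ge0 p : distribution p -> 0 <= entr R X p.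
Proof.
move=> p_dist; rewrite /entr -sumrN; apply: sumr_ge0 => x _.
rewrite /xlnx; case: ifP => _; first by rewrite oppr0.
by rewrite -mulrN mulr_ge0 ?p_dist.1// oppr_ge0 ln_le0// distribution_le1.
Qed.

Lemma entrE p : entr R X p = \sum_x p x * - ln (p x).
Proof.
rewrite /entr -sumrN; apply: eq_bigr => x _; rewrite /xlnx mulrN.
by case: eqP => // ->; rewrite mul0r.
Qed.

End Divergence.

Section PathLaws.
Context {R : realType} {X : finType}.
Implicit Types (k : seq X -> X -> R) (h past : seq X).

Fixpoint path_weight k past h : R :=
  if h is x :: h' then k past x * path_weight k (rcons past x) h' else 1.

Definition path_law k h : R := path_weight k [::] h.

Local Notation tuple_law k n := (fun h : n.-tuple X => path_law k h).

Lemma path_law_rcons k h x : path_law k (rcons h x) = path_law k h * k h x.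
Proof.
suff weight_rcons past :
    path_weight k past (rcons h x) = path_weight k past h * k (past ++ h) x.
  exact: weight_rcons.
elim: h past => [|y h IHh] past /=; first by rewrite cats0 mul1r mulr1.
by rewrite IHh mulrA cat_rcons.
Qed.

Lemma path_lawE k n (h : n.-tuple X) :
  path_law k h = \prod_(i < n) k (take i h) (tnth h i).
Proof.
suff weightE past :
    path_weight k past h = \prod_(i < n) k (past ++ take i h) (tnth h i).
  exact: weightE.
elim: n h past => [|n IHn] h past; first by rewrite big_ord0 [h]tuple0.
case/tupleP: h => x h; rewrite big_ord_recl/= cats0 tnth0 IHn; congr (_ * _).
by apply: eq_bigr => i _; rewrite cat_rcons tnthS.
Qed.

Lemma path_law_ge0 k h : (forall h x, 0 <= k h x) -> 0 <= path_law k h.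
Proof.
move=> k0; elim/last_ind: h => [|h x IHh]; first exact: ler01.
by rewrite path_law_rcons mulr_ge0.
Qed.

Lemma distribution_path_law k n : (forall h, distribution (k h)) ->
  distribution (tuple_law k n).
Proof.
move=> k_dist; split=> [h|].
  by apply: path_law_ge0 => h' x; exact: (k_dist _).1.
elim: n => [|n IHn]; first by rewrite sum_tuple0.
rewrite sum_rcons_tuple -IHn; apply: eq_bigr => h _.
under eq_bigr do rewrite path_law_rcons.
by rewrite -mulr_sumr (k_dist h).2 mulr1.
Qed.

Lemma path_law_gt0 k1 k2 h : (forall h x, 0 <= k1 h x) ->
    (forall h, 0 < path_law k1 h -> abscont (k1 h) (k2 h)) ->
  0 < path_law k1 h -> 0 < path_law k2 h.
Proof.
move=> k1_ge0 k12_abscont; elim/last_ind: h => [//|h x IHh].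
rewrite !path_law_rcons; have := path_law_ge0 h k1_ge0.
rewrite le_eqVlt => /predU1P[<-|h0]; first by rewrite mul0r ltxx.
by rewrite pmulr_rgt0// => x0; rewrite mulr_gt0 ?IHh// k12_abscont.
Qed.

Lemma kl_chain_rule k1 k2 n :
    (forall h, distribution (k1 h)) ->
    (forall h, 0 < path_law k1 h -> abscont (k1 h) (k2 h)) ->
  kl (tuple_law k1 n) (tuple_law k2 n)
  = \sum_(m < n) \sum_(h : m.-tuple X) path_law k1 h * kl (k1 h) (k2 h).
Proof.
move=> k1_dist k12_abscont.
have k1_ge0 h x : 0 <= k1 h x by exact: (k1_dist h).1.
elim: n => [|n IHn].
  by rewrite big_ord0 /kl sum_tuple0 /path_law/= subrr mulr0.
rewrite big_ord_recr/= -IHn /kl sum_rcons_tuple -big_split/=.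
under [RHS]eq_bigr do rewrite -mulrDr.
transitivity (\sum_(h : n.-tuple X) path_law k1 h * \sum_x k1 h x *
    (ln (path_law k1 (rcons h x)) - ln (path_law k2 (rcons h x)))).
  apply: eq_bigr => h _; rewrite mulr_sumr; apply: eq_bigr => x _.
  by rewrite /= path_law_rcons mulrA.
apply: eq_weighted_sum => [h|h _ h0]; first exact: path_law_ge0.
rewrite -[X in X + _]mul1r -(k1_dist h).2 mulr_suml -big_split/=.
under [RHS]eq_bigr do rewrite -mulrDr.
apply: eq_weighted_sum => [//|x _ x0]; rewrite !path_law_rcons !lnM ?posrE//.
- by ring.
- exact: path_law_gt0 h0.
- exact: k12_abscont h0 _ x0.
Qed.

End PathLaws.

Section FirstPassage.
Context {R : realType} {X : finType}.
Local Notation tuple_law k n := (fun h : n.-tuple X => path_law k h).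
Implicit Types (k : seq X -> X -> R) (h : seq X).
Variables (alive hit : pred (seq X)).
Hypothesis alive_rcons : forall h x, alive (rcons h x) -> alive h.
Hypothesis hit_rcons_alive : forall h x, hit (rcons h x) -> alive h.
Hypothesis hit_not_alive : forall h, hit h -> ~~ alive h.

Definition has_hit h : bool :=
  has (fun m => hit (take m h)) (iota 0 (size h).+1).

Lemma has_hit_rcons h x : has_hit (rcons h x) = has_hit h || hit (rcons h x).
Proof.
rewrite /has_hit size_rcons -[(size h).+2]addn1 iotaD has_cat has_seq1 add0n.
rewrite [take (size h).+1 _]take_oversize ?size_rcons//.
congr (_ || _); apply: eq_in_has => m.
rewrite mem_iota add0n ltnS => /andP[_ mh]; rewrite -cats1 take_cat.
by case: ltngtP mh => // ->; rewrite subnn take0 cats0 take_size.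
Qed.

Lemma has_hit_not_alive h : has_hit h -> ~~ alive h.
Proof.
elim/last_ind: h => [|h x IHh].
  by rewrite /has_hit/= orbF => /hit_not_alive.
rewrite has_hit_rcons => /orP[/IHh|/hit_not_alive//].
exact/contra/alive_rcons.
Qed.

Definition hit_prob k n : R := \sum_(h : n.-tuple X | hit h) path_law k h.

Lemma hit_prob_ge0 k n : (forall h, distribution (k h)) -> 0 <= hit_prob k n.
Proof.
move=> k_dist; apply: sumr_ge0 => h _.
exact: (distribution_path_law n k_dist).1.
Qed.

Lemma sum_has_hit k n : (forall h, distribution (k h)) ->
  \sum_(h : n.-tuple X | has_hit h) path_law k h = \sum_(m < n.+1) hit_prob k m.
Proof.
move=> k_dist; elim: n => [|n IHn].
  rewrite big_ord1; apply: eq_bigl => h.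
  by rewrite [h]tuple0 /has_hit/= orbF.
rewrite big_ord_recr/= -IHn /hit_prob [LHS]big_mkcond.
rewrite [X in _ = X + _]big_mkcond [X in _ = _ + X]big_mkcond !sum_rcons_tuple.
rewrite -big_split/=; apply: eq_bigr => h _.
under eq_bigr do rewrite has_hit_rcons.
case: ifP => [hh|_]; last by rewrite add0r.
have dead x : hit (rcons h x) = false.
  by apply: contraNF (has_hit_not_alive hh); exact: hit_rcons_alive.
under [X in _ + X]eq_bigr do rewrite dead.
rewrite big1_eq addr0 -[RHS]mulr1 -(k_dist h).2 mulr_sumr.
by apply: eq_bigr => x _; rewrite path_law_rcons.
Qed.

Definition possible_step k h x : Prop :=
  [/\ alive h, 0 < path_law k h & 0 < k h x].

Variables (k1 k2 : seq X -> X -> R).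
Hypothesis k1_dist : forall h, distribution (k1 h).
Hypothesis k2_dist : forall h, distribution (k2 h).
Hypothesis possible_step_gt0 : forall h x, possible_step k1 h x -> 0 < k2 h x.

(* Following k1 after the stopping time makes the two path laws comparable on
   the whole space of paths of a fixed length. *)
Definition stopped_kernel h : X -> R := if alive h then k2 h else k1 h.

Lemma distribution_stopped_kernel h : distribution (stopped_kernel h).
Proof. by rewrite /stopped_kernel; case: ifP. Qed.

Lemma abscont_stopped_kernel h :
  0 < path_law k1 h -> abscont (k1 h) (stopped_kernel h).
Proof.
move=> h0 x x0; rewrite /stopped_kernel; case: ifP => // ah.
exact: possible_step_gt0.
Qed.

Lemma path_law_stopped_alive h :
  alive h -> path_law stopped_kernel h = path_law k2 h.
Proof.
elim/last_ind: h => [//|h x IHh] /alive_rcons ah.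
by rewrite !path_law_rcons IHh// /stopped_kernel ah.
Qed.

Lemma hit_prob_stopped n : hit_prob stopped_kernel n = hit_prob k2 n.
Proof.
apply: eq_bigr => -[h /= _]; case/lastP: h => [//|h x] /hit_rcons_alive ah.
by rewrite !path_law_rcons path_law_stopped_alive// /stopped_kernel ah.
Qed.

Definition step_mean k n (F : seq X -> X -> R) : R :=
  \sum_(h : n.-tuple X | alive h) path_law k h * \sum_x k h x * F h x.

Definition step_kl n : R :=
  step_mean k1 n (fun h x => ln (k1 h x) - ln (k2 h x)).

Lemma kl_stopped n :
  kl (tuple_law k1 n) (tuple_law stopped_kernel n)
  = \sum_(m < n) step_kl m.
Proof.
rewrite kl_chain_rule//; last exact: abscont_stopped_kernel.
apply: eq_bigr => m _; rewrite /step_kl /step_mean [RHS]big_mkcond.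
apply: eq_bigr => h _; rewrite /stopped_kernel; case: ifP => // _.
by rewrite kl_self mulr0.
Qed.

Lemma hit_prob_gap n :
  \sum_(m < n.+1) hit_prob k1 m - \sum_(m < n.+1) hit_prob k2 m
  <= Num.sqrt (1 - expR (- \sum_(m < n) step_kl m)).
Proof.
under [X in _ - X]eq_bigr do rewrite -hit_prob_stopped.
rewrite -!sum_has_hit//; last exact: distribution_stopped_kernel.
rewrite -kl_stopped; apply: bretagnolle_huber.
- exact: distribution_path_law.
- exact/distribution_path_law/distribution_stopped_kernel.
- move=> h; apply: path_law_gt0; last exact: abscont_stopped_kernel.
  by move=> h' x; exact: (k1_dist h').1.
Qed.

Lemma step_kl_ge0 n : 0 <= step_kl n.
Proof.
apply: le_trans (_ : \sum_(h : n.-tuple X | alive h) path_law k1 h * 0 <= _).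
  by rewrite big1// => h _; rewrite mulr0.
apply: ler_weighted_sum => [h|h ah h0].
  exact: (distribution_path_law n k1_dist).1.
by apply: kl_ge0 => // x x0; exact: possible_step_gt0.
Qed.

Lemma ler_step_mean n (F G : seq X -> X -> R) :
    (forall h x, possible_step k1 h x -> F h x <= G h x) ->
  step_mean k1 n F <= step_mean k1 n G.
Proof.
move=> FG; apply: ler_weighted_sum => [h|h ah h0].
  exact: (distribution_path_law n k1_dist).1.
by apply: ler_weighted_sum => [x|x _ x0]; [exact: (k1_dist _).1|exact: FG].
Qed.

Lemma step_meanD k n F G :
  step_mean k n (fun h x => F h x + G h x) = step_mean k n F + step_mean k n G.
Proof.
rewrite /step_mean -big_split/=; apply: eq_bigr => h _.
rewrite -mulrDr -big_split/=.
by under [in RHS]eq_bigr do rewrite -mulrDr.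
Qed.

Lemma step_mean_sum k n (I : finType) (F : I -> seq X -> X -> R) :
  step_mean k n (fun h x => \sum_i F i h x) = \sum_i step_mean k n (F i).
Proof.
rewrite exchange_big/=; apply: eq_bigr => h _.
rewrite -mulr_sumr exchange_big/=.
by congr (_ * _); apply: eq_bigr => x _; rewrite mulr_sumr.
Qed.

End FirstPassage.

(* A history h of weight w h is followed by x with law k h, and r x is predicted
   from the partial observation u h of the histories in Q. *)
Section ConditionalLaws.
Context {R : realType} {H X V Y : finType}.
Variables (w : H -> R) (k : H -> X -> R) (Q : pred H) (u : H -> V) (r : X -> Y).
Hypothesis w_ge0 : forall h, 0 <= w h.
Hypothesis k_dist : forall h, distribution (k h).

Definition marginal v : R := \sum_(h | Q h && (u h == v)) w h.

Definition joint v y : R :=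
  \sum_(h | Q h && (u h == v)) w h * \sum_(x | r x == y) k h x.

Definition is_cond_law (q : V -> Y -> R) : Prop :=
  (forall v, 0 < marginal v -> forall y, q v y = joint v y / marginal v) /\
  (forall v, marginal v = 0 -> distribution (q v)).

Lemma marginal_ge0 v : 0 <= marginal v.
Proof. by apply: sumr_ge0. Qed.

Lemma fiber_sum_ge0 h y : 0 <= \sum_(x | r x == y) k h x.
Proof. by apply: sumr_ge0 => x _; exact: (k_dist h).1. Qed.

Lemma joint_ge0 v y : 0 <= joint v y.
Proof. by apply: sumr_ge0 => h _; rewrite mulr_ge0 ?fiber_sum_ge0. Qed.

Lemma sum_joint v : \sum_y joint v y = marginal v.
Proof.
rewrite exchange_big; apply: eq_bigr => h _.
rewrite -mulr_sumr (sum_fibers xpredT r (fun x _ => k h x)).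
by rewrite (k_dist h).2 mulr1.
Qed.

Variable q : V -> Y -> R.
Hypothesis q_cond : is_cond_law q.

Lemma distribution_cond_law v : distribution (q v).
Proof.
have := marginal_ge0 v; rewrite le_eqVlt => /predU1P[/esym/q_cond.2//|v0].
split=> [y|]; first by rewrite q_cond.1// divr_ge0 ?joint_ge0// ltW.
under eq_bigr do rewrite q_cond.1//.
by rewrite -mulr_suml sum_joint divff// gt_eqF.
Qed.

Lemma marginal_cond_law v y : marginal v * q v y = joint v y.
Proof.
have := marginal_ge0 v; rewrite le_eqVlt => /predU1P[v0|v0]; last first.
  by rewrite q_cond.1// mulrCA divff ?mulr1// gt_eqF.
rewrite -v0 mul0r; have joint0 : \sum_y joint v y = 0 by rewrite sum_joint.
by rewrite (psumr_eq0P (fun y _ => joint_ge0 v y) joint0).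
Qed.

Lemma cond_law_gt0 h x : Q h -> 0 < w h -> 0 < k h x -> 0 < q (u h) (r x).
Proof.
move=> Qh h0 x0; suff : 0 < joint (u h) (r x).
  rewrite -marginal_cond_law; apply: contraTT; rewrite -!leNgt => q_le0.
  by rewrite mulr_ge0_le0 ?marginal_ge0.
rewrite /joint (bigD1 h)/= ?Qh ?eqxx// ltr_pwDl//; last first.
  by apply: sumr_ge0 => h' _; rewrite mulr_ge0 ?fiber_sum_ge0.
rewrite mulr_gt0// (bigD1 x)//= ltr_pwDl//.
by apply: sumr_ge0 => x' _; exact: (k_dist h).1.
Qed.

Lemma cond_law_cross_entropy (a : V -> R) :
  \sum_(h | Q h) w h * \sum_x k h x * (a (u h) * - ln (q (u h) (r x)))
  = \sum_v a v * marginal v * entr R Y (q v).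
Proof.
rewrite -(sum_fibers Q u
  (fun h v => w h * \sum_x k h x * (a v * - ln (q v (r x))))).
apply: eq_bigr => v _; rewrite entrE -mulrA mulr_sumr.
under [in RHS]eq_bigr => y _ do rewrite mulrA marginal_cond_law mulr_suml.
rewrite exchange_big mulr_sumr; apply: eq_bigr => h _.
under [in RHS]eq_bigr => y _ do rewrite -mulrA mulr_suml.
rewrite -mulr_sumr (sum_fibers xpredT r (fun x y => k h x * - ln (q v y))).
rewrite mulrCA; congr (_ * _); rewrite mulr_sumr.
by apply: eq_bigr => x _; rewrite mulrCA.
Qed.

End ConditionalLaws.

Section NonnegativeSeries.
Context {R : realType}.
Implicit Types u v : nat -> R.

Lemma sum_le_nneseries u n : (forall m, 0 <= u m) ->
  ((\sum_(m < n) u m)%:E <= \sum_(0 <= m <oo) (u m)%:E)%E.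
Proof.
move=> u0; rewrite -sumEFin -(big_mkord xpredT (fun m => (u m)%:E)).
by apply: nneseries_lim_ge => m _ _; rewrite lee_fin.
Qed.

Lemma nneseriesB u v : (forall n, 0 <= v n <= u n) ->
    (\sum_(0 <= n <oo) (v n)%:E < +oo)%E ->
  (\sum_(0 <= n <oo) (u n - v n)%:E
   = \sum_(0 <= n <oo) (u n)%:E - \sum_(0 <= n <oo) (v n)%:E)%E.
Proof.
move=> uv v_fin; have v0 n : 0 <= v n by have /andP[] := uv n.
have uv0 n : 0 <= u n - v n by rewrite subr_ge0; have /andP[] := uv n.
rewrite [X in (_ = X - _)%E](_ : _ = \sum_(0 <= n <oo) (u n - v n)%:E
    + \sum_(0 <= n <oo) (v n)%:E)%E.
  rewrite addeK// ge0_fin_numE//; apply: nneseries_ge0 => n _ _.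
  by rewrite lee_fin.
rewrite -nneseriesD => [|n _ _|n _ _]; rewrite ?lee_fin//.
by apply: eq_eseriesr => n _; rewrite -EFinD subrK.
Qed.

Lemma nneseriesB_le u v b : (forall n, 0 <= u n) -> (forall n, 0 <= v n) ->
    (forall n, \sum_(m < n) u m - \sum_(m < n) v m <= b) ->
  (\sum_(0 <= n <oo) (u n)%:E - \sum_(0 <= n <oo) (v n)%:E <= b%:E)%E.
Proof.
move=> u0 v0 uvb; have v_ge n := sum_le_nneseries n v0.
move: v_ge; case: (limn _) => [sv||] v_ge; last 2 first.
- by rewrite addeNy leNye.
- by have := v_ge 0%N; rewrite leeNy_eq.
rewrite leeBlDr//; apply: lime_le.
  by apply: is_cvg_nneseries => n _ _; rewrite lee_fin.
apply: nearW => n; rewrite big_mkord sumEFin -EFinD lee_fin.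
have := v_ge n; rewrite lee_fin; have := uvb n; lra.
Qed.

End NonnegativeSeries.

Section Bound.
Context {R : realType}.

Lemma ler_bound (d : R) (D : \bar R) :
  (d%:E <= D)%E -> bound R d%:E <= bound R D.
Proof.
case: D => [r| |]/=; last by rewrite leeNy_eq.
- by rewrite lee_fin => dr; rewrite ler_wsqrtr// lerD2l lerN2 ler_expR lerN2.
- by rewrite -[X in _ <= X]sqrtr1 ler_wsqrtr// gerBl expR_ge0.
Qed.

Lemma bound_ge0 (D : \bar R) : 0 <= bound R D.
Proof. by case: D => [r||]; rewrite /= ?sqrtr_ge0 ?ler01. Qed.

End Bound.

Section Restrictions.
Context {R : numDomainType} {N : nat} {O L A : 'I_N -> finType}.
Local Notation step := (jA N A * jS N O L)%type.
Local Notation group_step c := (rA N A c * rO N O c * rL N L c)%type.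
Implicit Types (c : {set 'I_N}) (x y : step).

Definition restr_step c x : group_step c :=
  (restr N A x.1 c, restr N O x.2.1 c, restr N L x.2.2 c).

Lemma eq_restr (T : 'I_N -> finType) (f g : {dffun forall i, T i}) c i :
  restr N T f c = restr N T g c -> i \in c -> f i = g i.
Proof. by move=> /ffunP fg ic; have := fg (exist _ i ic); rewrite !ffunE. Qed.

Lemma eq_restr_step c x y i : restr_step c x = restr_step c y -> i \in c ->
  [/\ x.1 i = y.1 i, x.2.1 i = y.2.1 i & x.2.2 i = y.2.2 i].
Proof. by move=> [ea eo el] ic; split; apply: eq_restr ic. Qed.

Lemma eq_step x y :
  (forall i, [/\ x.1 i = y.1 i, x.2.1 i = y.2.1 i & x.2.2 i = y.2.2 i]) ->
  x = y.
Proof.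
move: x y => [xa [xo xl]] [ya [yo yl]] /= xy.
by congr (_, (_, _)); apply/ffunP => i; have [] := xy i.
Qed.

Definition split_space c : finType :=
  (group_step c * {dffun forall j : sub N (~: c), group_step [set val j]})%type.

Definition split_step c x : split_space c :=
  (restr_step c x, [ffun j : sub N (~: c) => restr_step [set val j] x]).

Lemma split_step_inj c : injective (split_step c).
Proof.
move=> x y xy; have [exy /ffunP exy'] := (congr1 fst xy, congr1 snd xy).
apply: eq_step => i; have [ic|ic] := boolP (i \in c).
  exact: eq_restr_step exy ic.
have ic' : i \in ~: c by rewrite inE.
have := exy' (exist _ i ic'); rewrite !ffunE => /eq_restr_step; apply.
exact: set11.
Qed.

Lemma card_group_step c :
  #|{: group_step c}| = (\prod_(i in c) (#|A i| * #|O i| * #|L i|))%N.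
Proof.
by rewrite !card_prod !card_dffun !big_split/= !(big_sub (mem c)).
Qed.

Lemma split_step_bij c : bijective (split_step c).
Proof.
apply: inj_card_bij; first exact: split_step_inj.
rewrite card_prod card_dffun card_group_step.
under [X in (_ * X)%N]eq_bigr => j _ do rewrite card_group_step big_set1.
rewrite -(big_sub (mem (~: c)) (fun i => #|A i| * #|O i| * #|L i|)%N)/=.
rewrite !card_prod !card_dffun mulnA -!big_split/= [leqRHS](bigID (mem c))/=.
by under [X in (_ * X <= _)%N]eq_bigl do rewrite finset.in_setC.
Qed.

Lemma distribution_split_step c (f : group_step c -> R)
    (g : forall i, group_step [set i] -> R) :
    distribution f -> (forall i, distribution (g i)) ->
  distribution (fun x => f (restr_step c x) *
    \prod_(i < N | i \notin c) g i (restr_step [set i] x)).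
Proof.
move=> f_dist g_dist.
have -> : (fun x => f (restr_step c x) *
      \prod_(i < N | i \notin c) g i (restr_step [set i] x))
    = (fun yz : split_space c => f yz.1 * \prod_j g (val j) (yz.2 j))
      \o split_step c.
  apply/funext => x /=; congr (_ * _).
  under eq_bigl do rewrite -finset.in_setC.
  by rewrite (big_sub (mem (~: c))); apply: eq_bigr => j _; rewrite ffunE.
apply: distribution_comp_bij; first exact: split_step_bij.
exact: (distribution_joint f_dist
  (fun=> distribution_dffun (fun j : sub N (~: c) => g_dist (val j)))).
Qed.

End Restrictions.

Section Histories.
Context {R : realType} {N : nat} {O L A : 'I_N -> finType}.
Variables (sinit : jS N O L) (Starg Savoid : {set jS N O L}).
Local Notation step := (jA N A * jS N O L)%type.
Local Notation stateAt h := (stateAt N O L A sinit _ h).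
Local Notation Eb h := (Eb N O L A sinit Starg Savoid _ h).
Implicit Type h : seq step.

Definition live (s : jS N O L) : bool := s \notin Tset N O L Starg Savoid.

Definition current h : jS N O L := last sinit (map snd h).

Definition alive h : bool := all live (sinit :: map snd h).

Definition hits_target h : bool :=
  all live (belast sinit (map snd h)) && (current h \in Starg).

Lemma alive_rcons h x : alive (rcons h x) -> alive h.
Proof. by rewrite /alive map_rcons -rcons_cons all_rcons => /andP[]. Qed.

Lemma hits_target_rcons_alive h x : hits_target (rcons h x) -> alive h.
Proof. by rewrite /hits_target map_rcons belast_rcons => /andP[]. Qed.

Lemma hits_target_not_alive h : hits_target h -> ~~ alive h.
Proof.
move=> /andP[_ target]; rewrite /alive lastI all_rcons.
by rewrite /live /Tset inE target.
Qed.

Lemma stateAt_take n (h : n.-tuple step) m :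
  (m <= n)%N -> stateAt h m = current (take m h).
Proof.
move=> mn; rewrite /current map_take (last_nth sinit).
rewrite size_takel ?size_map ?size_tuple//.
by rewrite -[_ :: take _ _]/(take m.+1 (_ :: _)) nth_take.
Qed.

Lemma stateAt_last n (h : n.-tuple step) : stateAt h n = current h.
Proof. by rewrite stateAt_take// take_oversize// size_tuple. Qed.

Lemma Eb_all n (h : n.-tuple step) m : (m <= n.+1)%N ->
  Eb h m = all live (take m (sinit :: map snd h)).
Proof.
move=> mn; have size_m : size (take m (sinit :: map snd h)) = m.
  by rewrite size_takel//= size_map size_tuple.
apply/forallP/(all_nthP sinit) => [Em i|all_live i].
  by rewrite size_m => im; rewrite nth_take//; exact: (Em (Ordinal im)).
by have := all_live i; rewrite size_m nth_take//; exact.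
Qed.

Lemma Eb_alive n (h : n.-tuple step) : Eb h n.+1 = alive h.
Proof. by rewrite Eb_all// take_oversize//= size_map size_tuple. Qed.

Lemma Eb_rcons_alive n (h : n.-tuple step) x :
  Eb (rcons_tuple h x) n.+1 = alive h.
Proof.
rewrite Eb_all//= map_rcons -cats1 take_cat size_map size_tuple ltnn subnn.
by rewrite take0 cats0.
Qed.

Lemma reached_now n (h : n.-tuple step) :
  Eb h n && (stateAt h n \in Starg) = hits_target h.
Proof.
rewrite stateAt_last Eb_all// lastI -cats1.
by rewrite take_size_cat// size_belast size_map size_tuple.
Qed.

Definition markov (ker : nat -> jS N O L -> step -> R) h : step -> R :=
  ker (size h).+1 (current h).

Lemma pathW_path_law ker n (h : n.-tuple step) :
  pathW R N O L A sinit ker n h = path_law (markov ker) h.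
Proof.
rewrite path_lawE; apply: eq_bigr => i _; rewrite /markov stateAt_take 1?ltnW//.
by rewrite size_takel// size_tuple ltnW.
Qed.

Lemma reachP_hit_prob ker :
  reachP R N O L A sinit Starg Savoid ker
  = (\sum_(0 <= n <oo) (hit_prob hits_target (markov ker) n)%:E)%E.
Proof.
apply: eq_eseriesr => n _; congr EFin; apply: eq_big => [h|h _].
  exact: reached_now.
exact: pathW_path_law.
Qed.

End Histories.

Section Game.
Context {R : realType} {N : nat} {O L A : 'I_N -> finType} {K : nat}.
Variable P : forall i, (O i * L i)%type -> A i -> {ffun (O i * L i)%type -> R}.
Arguments P : clear implicits.
Variables (sinit : jS N O L) (pcomm : jO N O -> {ffun Acomm N K -> R}).
Variables (pact : jS N O L -> {ffun jA N A -> R}).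
Variables (Starg Savoid : {set jS N O L}).
Variable q : q_family R N O L A.
Arguments q : clear implicits.
Hypothesis P_dist : forall i s a, is_dist R _ (P i s a).
Hypothesis pcomm_dist : forall o, is_dist R _ (pcomm o).
Hypothesis pact_dist : forall s, is_dist R _ (pact s).
Hypothesis q_cond : is_cond_family R N O L A P sinit pact Starg Savoid q.

Local Notation step := (jA N A * jS N O L)%type.
Local Notation group_step c := (rA N A c * rO N O c * rL N L c)%type.
Local Notation current := (current sinit).
Local Notation alive := (alive sinit Starg Savoid).
Local Notation wprime := (wprime R N O K pcomm).
Local Notation den := (Defs.den R N O L A P sinit pact Starg Savoid).
Local Notation num := (Defs.num R N O L A P sinit pact Starg Savoid).
Local Notation Hent := (Hent R N O L A P sinit pact Starg Savoid).
Local Notation full_kernel := (markov sinit (kfull R N O L A P pact)).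
Local Notation restricted_kernel := (markov sinit (khat R N O L A K pcomm q)).
Local Notation tuple_law n := (fun h : n.-tuple step => path_law full_kernel h).
Implicit Types (h : seq step) (x : step) (c : {set 'I_N}).

Definition local_states (s : jS N O L) :
    {dffun forall i : 'I_N, (O i * L i)%type} := [ffun i => (s.1 i, s.2 i)].

Lemma local_states_bij : bijective local_states.
Proof.
exists (fun f : {dffun forall i : 'I_N, (O i * L i)%type} =>
  ([ffun i => (f i).1] : jO N O, [ffun i => (f i).2] : jL N L)).
  by move=> [pub loc]; congr pair; apply/ffunP => i; rewrite !ffunE.
by move=> f; apply/ffunP => i; rewrite !ffunE -surjective_pairing.
Qed.

Lemma distribution_full_kernel h : distribution (full_kernel h).
Proof.
apply: distribution_joint => [|a]; first exact: pact_dist.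
set s := current h.
have -> : Pj R N O L A P s a
    = (fun f : {dffun forall i, _} => \prod_i P i (s.1 i, s.2 i) (a i) (f i))
      \o local_states.
  by apply/funext => u; apply: eq_bigr => i _; rewrite ffunE.
apply: distribution_comp_bij; first exact: local_states_bij.
apply: (distribution_dffun (p := fun i => P i (s.1 i, s.2 i) (a i))) => i.
exact: P_dist.
Qed.

Lemma full_law_ge0 h : 0 <= path_law full_kernel h.
Proof.
by apply: path_law_ge0 => h' x; exact: (distribution_full_kernel h').1.
Qed.

Definition view c h : jO N O * rL N L c :=
  ((current h).1, restr N L (current h).2 c).

Local Notation viewed_mass n c :=
  (marginal (tuple_law n) alive (view c)).
Local Notation viewed_joint n c :=
  (joint (tuple_law n) full_kernel alive (view c) (restr_step c)).

Lemma den_marginal n c o lc : den n c o lc = viewed_mass n c (o, lc).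
Proof.
apply: eq_big => [h|h _]; last exact: pathW_path_law.
by rewrite Eb_alive stateAt_last xpair_eqE.
Qed.

Lemma num_joint n c o lc y : num n c o lc y = viewed_joint n c (o, lc) y.
Proof.
rewrite /Defs.num /joint big_mkcond sum_rcons_tuple [RHS]big_mkcond.
apply: eq_bigr => h _.
transitivity
    (\sum_x if alive h && (view c h == (o, lc)) && (restr_step c x == y)
            then path_law full_kernel h * full_kernel h x else 0).
  apply: eq_bigr => x _; rewrite pathW_path_law path_law_rcons.
  congr (if _ then _ else _); rewrite Eb_rcons_alive stateAt_take//.
  rewrite (tnth_nth x)/= nth_rcons size_tuple ltnn eqxx.
  rewrite -cats1 take_size_cat ?size_tuple//.
  by case: y => -[ya yo] yl; rewrite !xpair_eqE -!andbA.
rewrite mulr_sumr.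
by case: (alive h && _); [rewrite [RHS]big_mkcond|rewrite big1_eq].
Qed.

Lemma q_cond_law n c :
  is_cond_law (tuple_law n) full_kernel alive (view c) (restr_step c)
    (fun v => q n.+1 c v.1 v.2).
Proof.
split=> [[pub loc] mass_gt0 y|[pub loc] mass0] /=.
  by rewrite (proj1 q_cond) ?den_marginal// num_joint.
by apply: (proj2 q_cond); rewrite den_marginal.
Qed.

Definition group_law c h : group_step c -> R :=
  q (size h).+1 c (current h).1 (restr N L (current h).2 c).
Arguments group_law : clear implicits.

Lemma distribution_q n c o lc : distribution (q n.+1 c o lc).
Proof.
apply: (distribution_cond_law _ _ (q_cond_law n c) (o, lc)) => h.
  exact: full_law_ge0.
exact: distribution_full_kernel.
Qed.

Lemma distribution_group_law c h : distribution (group_law c h).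
Proof. exact: distribution_q. Qed.

Local Notation mean := (step_mean alive full_kernel).
Local Notation possible := (possible_step alive full_kernel).

Lemma group_law_gt0 c h x :
  possible h x -> 0 < group_law c h (restr_step c x).
Proof.
case; apply: (cond_law_gt0 _ _ (q_cond_law (size h) c) (h := in_tuple h)) => h'.
  exact: full_law_ge0.
exact: distribution_full_kernel.
Qed.

Definition group_entropy n c (w : jO N O -> R) : R :=
  \sum_o \sum_lc w o * den n c o lc * entr R _ (q n.+1 c o lc).

Lemma group_entropy_ge0 n c w :
  (forall o, 0 <= w o) -> 0 <= group_entropy n c w.
Proof.
move=> w0; apply: sumr_ge0 => o _; apply: sumr_ge0 => lc _.
rewrite den_marginal mulr_ge0 ?mulr_ge0 ?entr_ge0//; last exact: distribution_q.
by apply: marginal_ge0 => h; exact: full_law_ge0.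
Qed.

Lemma group_entropyE n c w : group_entropy n c w
  = mean n (fun h x => w (current h).1 * - ln (group_law c h (restr_step c x))).
Proof.
pose mass := viewed_mass n c.
transitivity (\sum_v w v.1 * mass v * entr R _ (q n.+1 c v.1 v.2)).
  rewrite /group_entropy pair_bigA; apply: eq_bigr => -[pub loc] _.
  by rewrite den_marginal.
rewrite -(cond_law_cross_entropy (fun h : n.-tuple step => full_law_ge0 h)
  (fun h : n.-tuple step => distribution_full_kernel h) (q_cond_law n c)
  (fun v => w v.1)).
apply: eq_bigr => h _; congr (_ * _); apply: eq_bigr => x _.
by rewrite /group_law size_tuple.
Qed.

Definition comm_law c h x : R :=
  group_law c h (restr_step c x) *
  \prod_(i < N | i \notin c) group_law [set i] h (restr_step [set i] x).

Lemma distribution_comm_law c h : distribution (comm_law c h).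
Proof.
exact: distribution_split_step (distribution_group_law c h)
  (fun i => distribution_group_law [set i] h).
Qed.

Lemma comm_law_gt0 c h x : possible h x -> 0 < comm_law c h x.
Proof.
move=> hx; rewrite mulr_gt0 ?group_law_gt0//.
by apply: prodr_gt0 => i _; exact: group_law_gt0.
Qed.

Lemma restricted_kernelE h x : restricted_kernel h x
  = \sum_(c : Acomm N K) pcomm (current h).1 c * comm_law (val c) h x.
Proof. by apply: eq_bigr => c _; rewrite /comm_law mulrA. Qed.

Lemma distribution_restricted_kernel h : distribution (restricted_kernel h).
Proof.
rewrite (funext (restricted_kernelE h)); apply: distribution_mix => [|c].
  exact: pcomm_dist.
exact: distribution_comm_law.
Qed.

Lemma restricted_kernel_gt0 h x : possible h x -> 0 < restricted_kernel h x.
Proof.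
move=> hx; rewrite restricted_kernelE.
apply: weighted_sum_gt0; first exact: pcomm_dist.
by move=> c _; exact: comm_law_gt0.
Qed.

Lemma ln_comm_law c h x : possible h x ->
  - ln (comm_law c h x) = - ln (group_law c h (restr_step c x)) +
    \sum_(i < N | i \notin c) - ln (group_law [set i] h (restr_step [set i] x)).
Proof.
move=> hx; rewrite /comm_law lnM ?posrE ?group_law_gt0//; last first.
  by apply: prodr_gt0 => i _; exact: group_law_gt0.
rewrite ln_prod => [|i _]; last exact: group_law_gt0.
by rewrite opprD sumrN.
Qed.

Lemma ln_restricted_kernel_ge h x : possible h x ->
  - ln (restricted_kernel h x) <=
    \sum_(i < N) wprime (current h).1 i
      * - ln (group_law [set i] h (restr_step [set i] x)) +
    \sum_c pcomm (current h).1 c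
      * - ln (group_law (val c) h (restr_step (val c) x)).
Proof.
move=> hx; rewrite restricted_kernelE.
apply: le_trans (_ : \sum_(c : Acomm N K)
  pcomm (current h).1 c * - ln (comm_law (val c) h x) <= _).
  under [leRHS]eq_bigr do rewrite mulrN.
  rewrite sumrN lerN2; apply: jensen_ln; first exact: pcomm_dist.
  by move=> c _; exact: comm_law_gt0.
under eq_bigr do rewrite ln_comm_law// mulrDr.
rewrite big_split/= addrC lerD2r /Defs.wprime.
under [leRHS]eq_bigr do rewrite mulr_suml big_mkcond/=.
rewrite exchange_big/=; apply: ler_sum => c _.
by rewrite -big_mkcond/= -mulr_sumr.
Qed.

Definition comm_cost n : R :=
  \sum_(i < N) group_entropy n [set i] (wprime^~ i)
  + \sum_(c : Acomm N K) group_entropy n (val c) (pcomm^~ c).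

Lemma HentE n : Hent n = mean n (fun h x => - ln (full_kernel h x)).
Proof.
apply: eq_big => [h|h _]; first exact: Eb_alive.
by rewrite pathW_path_law entrE stateAt_last.
Qed.

Local Notation step_divergence := (step_kl alive full_kernel restricted_kernel).

Lemma step_divergence_le n : step_divergence n <= comm_cost n - Hent n.
Proof.
rewrite /comm_cost; under eq_bigr do rewrite group_entropyE.
under [X in _ + X - _]eq_bigr do rewrite group_entropyE.
rewrite -!step_mean_sum -step_meanD HentE lerBrDr -step_meanD.
apply: (ler_step_mean distribution_full_kernel) => h x hx.
rewrite addrAC subrr add0r; exact: ln_restricted_kernel_ge.
Qed.

Lemma Hent_ge0 n : 0 <= Hent n.
Proof.
rewrite /Defs.Hent; apply: sumr_ge0 => h _; rewrite pathW_path_law.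
rewrite mulr_ge0 ?full_law_ge0// entr_ge0// stateAt_last.
exact: distribution_full_kernel.
Qed.

Lemma step_divergence_ge0 n : 0 <= step_divergence n.
Proof.
apply: step_kl_ge0 => h; first exact: distribution_full_kernel.
  exact: distribution_restricted_kernel.
exact: restricted_kernel_gt0.
Qed.

Lemma Hent_le_comm_cost n : Hent n <= comm_cost n.
Proof.
by rewrite -subr_ge0 (le_trans (step_divergence_ge0 n))// step_divergence_le.
Qed.

Local Notation Hsum := (Hsum R N O L A P sinit pact Starg Savoid).
Local Notation Dcost := (Dcost R N O L A K P sinit pact pcomm Starg Savoid q).

Lemma Dcost_series : (Hsum < +oo)%E ->
  Dcost = (\sum_(0 <= n <oo) (comm_cost n - Hent n)%:E)%E.
Proof.
move=> Hsum_fin; have agent_ge0 n i : 0 <= group_entropy n [set i] (wprime^~ i).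
  apply: group_entropy_ge0 => o; apply: sumr_ge0 => c _.
  exact: (proj1 (pcomm_dist o)).
have comm_ge0 n (c : Acomm N K) : 0 <= group_entropy n (val c) (pcomm^~ c).
  by apply: group_entropy_ge0 => o; exact: (proj1 (pcomm_dist o)).
rewrite nneseriesB// => [|n]; last by rewrite Hent_ge0 Hent_le_comm_cost.
congr (_ - _)%E; rewrite /comm_cost.
under [RHS]eq_eseriesr do rewrite EFinD -!sumEFin.
rewrite nneseriesD; last 2 first.
- by move=> n _ _; apply: sume_ge0 => i _; rewrite lee_fin.
- by move=> n _ _; apply: sume_ge0 => c _; rewrite lee_fin.
by congr (_ + _)%E; rewrite nneseries_sum// => i n _; rewrite lee_fin.
Qed.

Local Notation reach_prob := (hit_prob (hits_target sinit Starg Savoid)).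

Lemma reach_gap_le_bound n : (Hsum < +oo)%E ->
  \sum_(m < n) reach_prob full_kernel m
  - \sum_(m < n) reach_prob restricted_kernel m
  <= bound R Dcost.
Proof.
move=> Hsum_fin; case: n => [|n]; first by rewrite !big_ord0 subrr bound_ge0.
apply: (@le_trans _ _ (bound R (\sum_(m < n) step_divergence m)%:E)).
  apply: (hit_prob_gap _ _ _ distribution_full_kernel
    distribution_restricted_kernel restricted_kernel_gt0) => h.
  - exact: alive_rcons.
  - exact: hits_target_rcons_alive.
  - exact: hits_target_not_alive.
apply: ler_bound; rewrite Dcost_series//.
apply: le_trans (sum_le_nneseries n _) => [|m].
  by rewrite lee_fin; apply: ler_sum => m _; exact: step_divergence_le.
by rewrite subr_ge0 Hent_le_comm_cost.
Qed.

End Game.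

Unset Implicit Arguments.

Theorem theorem1 (R : realType) (N : nat) (O L A : 'I_N -> finType) (K : nat)
  (P : forall i : 'I_N, (O i * L i)%type -> A i -> {ffun (O i * L i)%type -> R})
  (sinit : jS N O L)
  (pcomm : jO N O -> {ffun Acomm N K -> R})
  (pact : jS N O L -> {ffun jA N A -> R})
  (Starg Savoid : {set jS N O L})
  (q : q_family R N O L A) :
  (K <= N)%N ->
  (forall i s a, is_dist R _ (P i s a)) ->
  (forall o, is_dist R _ (pcomm o)) ->
  (forall s, is_dist R _ (pact s)) ->
  [disjoint Starg & Savoid] ->
  is_cond_family R N O L A P sinit pact Starg Savoid q ->
  (Hsum R N O L A P sinit pact Starg Savoid < +oo)%E ->
  (reachP R N O L A sinit Starg Savoid (kfull R N O L A P pact)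
   - reachP R N O L A sinit Starg Savoid (khat R N O L A K pcomm q)
   <= (bound R (Dcost R N O L A K P sinit pact pcomm Starg Savoid q))%:E)%E.
Proof.
move=> _ P_dist pcomm_dist pact_dist _ q_cond Hsum_fin.
rewrite !reachP_hit_prob.
apply: nneseriesB_le => n.
- exact/hit_prob_ge0/distribution_full_kernel.
- exact: hit_prob_ge0
    (distribution_restricted_kernel P_dist pcomm_dist pact_dist q_cond).
- exact: reach_gap_le_bound.
Qed.
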